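(* Let $D$ be an integral domain and $\star$ a semistar operation on $D$. The following are equivalent: (1) $D$ is a $\star$-Dedekind domain ($\star$-DD). (2) $D$ is a $\star$-almost Dedekind domain ($\star$-ADD) and each nonzero element of $D$ is contained in only finitely many quasi-$\star_f$-maximal ideals. (3) $D$ is a $\star$-Noetherian domain and a $\star$-almost Dedekind domain.
   Context: Let $D$ be an integral domain with quotient field $K$. $\overline{\boldsymbol F}(D)$ denotes the set of all nonzero $D$-submodules of $K$, and $\boldsymbol f(D)$ the set of nonzero finitely generated $D$-submodules of $K$. A semistar operation on $D$ is a map $\star:\overline{\boldsymbol F}(D)\to\overline{\boldsymbol F}(D)$, $E\mapsto E^\star$, such that for all $0\neq x\in K$ and $E,F\in\overline{\boldsymbol F}(D)$: $(xE)^\star=xE^\star$; $E\subseteq F$ implies $E^\star\subseteq F^\star$; $E\subseteq E^\star$ and $(E^\star)^\star=E^\star$. The semistar operation $\star_f$ is defined by $E^{\star_f}:=\bigcup\{F^\star : F\in\boldsymbol f(D),\ F\subseteq E\}$. A quasi-$\star$-ideal of $D$ is a nonzero ideal $I$ of $D$ with $I=I^\star\cap D$. $\mathcal{M}(\star_f)$ is the set of quasi-$\star_f$-maximal ideals, i.e. the maximal elements of the set of proper quasi-$\star_f$-ideals of $D$ (these are prime). $D$ is a $\star$-almost Dedekind domain ($\star$-ADD) if $D_M$ is a rank-one discrete valuation domain for each $M\in\mathcal{M}(\star_f)$. $D$ is $\star$-Noetherian if it has the ascending chain condition on quasi-$\star$-ideals. A nonzero ideal $I$ is $\star$-invertible if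 $(II^{-1})^\star=D^\star$, where $I^{-1}=\{z\in K: zI\subseteq D\}$. $D$ is a P$\star$MD if each nonzero finitely generated ideal of $D$ is $\star_f$-invertible. $D$ is a $\star$-Dedekind domain ($\star$-DD) if it is $\star$-Noetherian and a P$\star$MD. *)

(* Defs.v *)
From HB Require Import structures.
From mathcomp Require Import all_boot all_order all_algebra.
From mathcomp Require Import boolp classical_sets functions cardinality.

Set Implicit Arguments.
Unset Strict Implicit.
Unset Printing Implicit Defensive.

Import GRing.Theory.
Local Open Scope classical_set_scope.
Local Open Scope ring_scope.

(** A rank-one discrete valuation ring of a field [K] is the ring of a
    surjective valuation [v] from the nonzero elements of [K] to [int];
    the value [v 0] is irrelevant. *)
Record discrete_valuation (K : fieldType) (v : K -> int) : Prop := {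
  dvalM : forall x y, x != 0 -> y != 0 -> v (x * y) = v x + v y;
  dvalD : forall x y, x != 0 -> y != 0 -> x + y != 0 ->
    Order.min (v x) (v y) <= v (x + y);
  dval_surj : forall k : int, exists2 x, x != 0 & v x = k
}.

Definition is_DVR (K : fieldType) (V : set K) : Prop :=
  exists2 v : K -> int, discrete_valuation v &
    V = [set x | x = 0 \/ 0 <= v x].

Section Semistar.
Variable D : idomainType.
Local Notation K := {fraction D}.

(** The copy of [D] inside its quotient field [K].  Ideals of [D] are
    represented by the [D]-submodules of [K] contained in it. *)
Definition domK : set K := range (@FracField.tofrac D).

Record submodule (E : set K) : Prop := {
  submod0 : E 0;
  submodD : forall x y, E x -> E y -> E (x + y);
  submodZ : forall (a : D) x, E x -> E (FracField.tofrac a * x)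
}.

Definition nonzero_submodule (E : set K) : Prop :=
  submodule E /\ exists2 x, E x & x != 0.

Definition span (s : seq K) : set K :=
  [set x | exists c : 'I_(size s) -> D,
     x = \sum_(i < size s) FracField.tofrac (c i) * s`_i].

Definition nonzero_fg_submodule (E : set K) : Prop :=
  nonzero_submodule E /\ exists s : seq K, E = span s.

Definition scale_set (x : K) (E : set K) : set K := [set x * y | y in E].

(** Only the values of [star] on nonzero [D]-submodules of [K] matter. *)
Record semistar (star : set K -> set K) : Prop := {
  semistar_submodule : forall E,
    nonzero_submodule E -> nonzero_submodule (star E);
  semistarZ : forall x E, x != 0 -> nonzero_submodule E ->
    star (scale_set x E) = scale_set x (star E);
  semistar_mono : forall E F, nonzero_submodule E -> nonzero_submodule F ->
    E `<=` F -> star E `<=` star F;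
  semistar_ext : forall E, nonzero_submodule E -> E `<=` star E;
  semistar_idem : forall E, nonzero_submodule E -> star (star E) = star E
}.

Definition star_f (star : set K -> set K) (E : set K) : set K :=
  \bigcup_(F in [set F | nonzero_fg_submodule F /\ F `<=` E]) star F.

Definition nonzero_ideal (I : set K) : Prop :=
  nonzero_submodule I /\ I `<=` domK.

Definition quasi_star_ideal (star : set K -> set K) (I : set K) : Prop :=
  nonzero_ideal I /\ I = star I `&` domK.

Definition quasi_star_maximal (star : set K -> set K) (M : set K) : Prop :=
  [/\ quasi_star_ideal star M, M <> domK &
      forall J, quasi_star_ideal star J -> J <> domK -> M `<=` J -> J = M].

(** [D_M], for a prime ideal [M]. *)
Definition localization (M : set K) : set K :=
  [set x | exists a s, [/\ domK a, domK s, ~ M s & x = a / s]].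

Definition star_ADD (star : set K -> set K) : Prop :=
  forall M, quasi_star_maximal (star_f star) M -> is_DVR (localization M).

Definition star_Noetherian (star : set K -> set K) : Prop :=
  forall I : nat -> set K,
    (forall n, quasi_star_ideal star (I n)) ->
    (forall n, I n `<=` I n.+1) ->
    exists n, forall m, (n <= m)%N -> I m = I n.

Definition ideal_inv (I : set K) : set K :=
  [set z | scale_set z I `<=` domK].

Definition submodule_mul (E F : set K) : set K :=
  [set x | exists (n : nat) (e f : 'I_n -> K),
     [/\ forall i, E (e i), forall i, F (f i) & x = \sum_(i < n) e i * f i]].

Definition star_invertible (star : set K -> set K) (I : set K) : Prop :=
  star (submodule_mul I (ideal_inv I)) = star domK.

Definition PstarMD (star : set K -> set K) : Prop :=
  forall I, nonzero_ideal I -> nonzero_fg_submodule I ->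
    star_invertible (star_f star) I.

Definition star_DD (star : set K -> set K) : Prop :=
  star_Noetherian star /\ PstarMD star.

Definition finite_maximal_character (star : set K -> set K) : Prop :=
  forall d : D, d != 0 ->
    finite_set [set M | quasi_star_maximal (star_f star) M /\
                        M (FracField.tofrac d)].

End Semistar.

(* Main.v *)
From Pilot Require Import Defs.
From mathcomp Require Import all_boot all_order all_algebra.
From mathcomp Require Import boolp classical_sets functions cardinality.
(* all_algebra shadows [span]. *)
Import Pilot.Defs.

(** Write [t] for [star_f star], a semistar operation of finite type with the
    same chain condition as [star].  The argument is local at each
    quasi-[t]-maximal ideal [M].  The key fact is that if [D_M] is a valuation
    ring, then [E^t] is contained in [E D_M]; hence contractions to [D] of
    [D_M]-submodules are quasi-[t]-ideals and the chain condition on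
    quasi-[t]-ideals passes to [D_M], making it discrete.
    Invertibility of the finitely generated ideals amounts to all [D_M] being
    valuation rings, because [I I^-1] lies in no quasi-[t]-maximal ideal.
    In the presence of the chain condition, Noetherian induction shows that
    finitely many [M] lie above each quasi-[t]-ideal: a nonprime [I] reduces to
    [(I, a)] and [(I, b)], and a nonzero prime below [M] equals [M] since
    [D_M] has rank one.  Conversely, an element of [I_m] belongs to a
    quasi-[t]-ideal [I_n] as soon as it does so after localization at the
    finitely many [M] containing a fixed nonzero element of [I_0], and the
    chain stabilises in each of these discrete valuation rings. *)

Set Implicit Arguments.
Unset Strict Implicit.
Unset Printing Implicit Defensive.

Import Order.TTheory GRing.Theory Num.Theory.
Local Open Scope classical_set_scope.
Local Open Scope ring_scope.

(** * Fractions, submodules of the quotient field, and spans *)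

Section Fractions.
Variable D : idomainType.
Local Notation K := {fraction D}.
Local Notation domK := (@domK D).
Implicit Types (x y : K) (E F : set K) (s : seq K).

Lemma fraction_quotient x : exists a b : K, [/\ domK a, domK b, b != 0 & x = a / b].
Proof.
elim/quotW: x => r.
exists (FracField.tofrac (\n_r)), (FracField.tofrac (\d_r)).
have d0 := denom_ratioP r.
split; [by exists (\n_r) | by exists (\d_r) | by rewrite tofrac_eq0 |].
apply: (canRL (mulfK _)); first by rewrite tofrac_eq0.
rewrite [_ * _]piE [RHS]piE; apply/eqmodP.
rewrite /= FracField.equivfE /FracField.mulf /=.
by rewrite !numden_Ratio ?mulr1 ?oner_neq0 // mulrC.
Qed.

Lemma domK0 : domK 0. Proof. by exists 0; rewrite ?tofrac0. Qed.
Lemma domK1 : domK 1. Proof. by exists 1; rewrite ?tofrac1. Qed.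
Lemma domKD x y : domK x -> domK y -> domK (x + y).
Proof. by move=> [a _ <-] [b _ <-]; exists (a + b); rewrite ?tofracD. Qed.
Lemma domKM x y : domK x -> domK y -> domK (x * y).
Proof. by move=> [a _ <-] [b _ <-]; exists (a * b); rewrite ?tofracM. Qed.

Lemma submodM E a x : submodule E -> domK a -> E x -> E (a * x).
Proof. by move=> [_ _ EZ] [d _ <-]; exact: EZ. Qed.

Lemma submodule_sum E n (f : 'I_n -> K) :
  submodule E -> (forall i, E (f i)) -> E (\sum_(i < n) f i).
Proof. by move=> [E0 ED _] Ef; elim/big_ind: _. Qed.

Lemma submodule_domK : submodule domK.
Proof. by split=> [||a x]; [exact: domK0 | exact: domKD | apply: domKM; exists a]. Qed.

Lemma submoduleI E F : submodule E -> submodule F -> submodule (E `&` F).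
Proof.
move=> sE sF; split=> [|x y [Ex Fx] [Ey Fy]|a x [Ex Fx]].
- by split; apply: submod0.
- by split; apply: submodD.
- by split; apply: submodZ.
Qed.

Lemma mem_scale_set x E y : x != 0 -> scale_set x E y <-> E (y / x).
Proof.
move=> x0; split=> [[z Ez <-]|Ey]; first by rewrite mulrC mulKf.
by exists (y / x) => //; rewrite mulrC divfK.
Qed.

Lemma submodule_scale x E : submodule E -> submodule (scale_set x E).
Proof.
move=> sE; split.
- by exists 0; [exact: submod0 | rewrite mulr0].
- move=> _ _ [y Ey <-] [z Ez <-]; exists (y + z); last by rewrite mulrDr.
  exact: submodD.
- move=> a _ [y Ey <-]; exists (FracField.tofrac a * y); last by rewrite mulrCA.
  exact: submodZ.
Qed.

Lemma nonzero_submodule_scale x E :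
  x != 0 -> nonzero_submodule E -> nonzero_submodule (scale_set x E).
Proof.
move=> x0 [sE [y Ey y0]]; split; first exact: submodule_scale.
by exists (x * y); [exists y | rewrite mulf_neq0].
Qed.

Lemma nonzero_submodule_domK : nonzero_submodule domK.
Proof.
by split; [exact: submodule_domK | exists 1; [exact: domK1 | exact: oner_neq0]].
Qed.

Lemma nonzero_submodule_sub E F :
  nonzero_submodule E -> submodule F -> E `<=` F -> nonzero_submodule F.
Proof. by move=> [_ [x Ex x0]] sF EF; split=> //; exists x; [exact: EF|]. Qed.

Lemma spanP s E : submodule E -> span s `<=` E <-> (forall x, x \in s -> E x).
Proof.
move=> sE; split=> [sub x xs|Es _ [c ->]]; last first.
  by apply: submodule_sum => // i; apply: submodZ => //; apply: Es; exact: mem_nth.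
have xi : (index x s < size s)%N by rewrite index_mem.
apply: sub; exists (fun i => (i == Ordinal xi)%:R).
rewrite (bigD1 (Ordinal xi)) //= eqxx tofrac1 mul1r nth_index //.
by rewrite big1 ?addr0 // => i /negPf ->; rewrite tofrac0 mul0r.
Qed.

Lemma submodule_span s : submodule (span s).
Proof.
split.
- exists (fun=> 0); rewrite big1 // => i _; by rewrite tofrac0 mul0r.
- move=> _ _ [c ->] [d ->]; exists (fun i => c i + d i).
  by rewrite -big_split; apply: eq_bigr => i _; rewrite tofracD mulrDl.
- move=> a _ [c ->]; exists (fun i => a * c i).
  by rewrite mulr_sumr; apply: eq_bigr => i _; rewrite tofracM mulrA.
Qed.

Lemma mem_span s x : x \in s -> span s x.
Proof. exact: (spanP s (submodule_span s)).1. Qed.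

Lemma nonzero_fg_span s x : x \in s -> x != 0 -> nonzero_fg_submodule (span s).
Proof.
move=> xs x0; split; last by exists s.
by split; [exact: submodule_span | exists x => //; exact: mem_span].
Qed.

(** If all the generators vanished, the span would lie in the zero submodule. *)
Lemma nonzero_fgP F : nonzero_fg_submodule F ->
  exists2 s, F = span s & exists2 x, x \in s & x != 0.
Proof.
move=> [[sF [x Fx x0]] [s Fs]]; exists s => //.
apply: contrapT => s0; move/eqP: x0; apply.
have sZ : submodule [set (0 : K)].
  by split=> // [_ _ -> ->|a _ ->]; rewrite ?addr0 ?mulr0.
move: Fx; rewrite Fs => /((spanP s sZ).2 _); apply=> y ys.
by apply: contrapT => /eqP y0; apply: s0; exists y.
Qed.
End Fractions.

(** * Operations of finite type and the semistar operation [star_f star] *)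

Section FiniteType.
Variable D : idomainType.
Local Notation K := {fraction D}.
Local Notation domK := (@domK D).
Implicit Types (x y : K) (E F : set K) (s : seq K).

(** Only the inclusion of $E^t$ in the union of the $F^t$ is asked; the reverse one is
    monotonicity. *)
Definition finite_type (t : set K -> set K) : Prop :=
  forall E x, nonzero_submodule E -> t E x ->
    exists F, [/\ nonzero_fg_submodule F, F `<=` E & t F x].

Lemma scale_set_span x s : scale_set x (span s) = span [seq x * y | y <- s].
Proof.
apply/seteqP; split.
- move=> _ [y + <-].
  have sub : submodule [set y | span [seq x * z | z <- s] (x * y)].
    split=> /=; first by rewrite mulr0; exact: submod0 (submodule_span _).
    - by move=> u v su sv; rewrite mulrDr; exact: submodD (submodule_span _) _ _ su sv.
    - by move=> a u su; rewrite mulrCA; exact: submodZ (submodule_span _) _ _ su.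
  by apply: (spanP s sub).2 => z zs; apply: mem_span; exact: map_f.
- apply/spanP; first exact/submodule_scale/submodule_span.
  by move=> _ /mapP[y ys ->]; exists y => //; exact: mem_span.
Qed.

Lemma nonzero_fg_scale x F :
  x != 0 -> nonzero_fg_submodule F -> nonzero_fg_submodule (scale_set x F).
Proof.
move=> x0 [nF [s Fs]]; split; first exact: nonzero_submodule_scale.
by exists [seq x * y | y <- s]; rewrite Fs scale_set_span.
Qed.

(** The finitely generated submodules of [E] are directed, hence so is the union defining [star_f];
    its closure under sums and its idempotence rest on this. *)
Lemma nonzero_fg_join F G E :
    submodule E -> nonzero_fg_submodule F -> nonzero_fg_submodule G ->
    F `<=` E -> G `<=` E ->
  exists H, [/\ nonzero_fg_submodule H, H `<=` E, F `<=` H & G `<=` H].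
Proof.
move=> sE /nonzero_fgP[s -> [x xs x0]] [_ [u ->]] /(spanP s sE) sub1 /(spanP u sE) sub2.
exists (span (s ++ u)); split.
- by apply: nonzero_fg_span x0; rewrite mem_cat xs.
- by apply/spanP => // y; rewrite mem_cat => /orP[/sub1|/sub2].
- by apply/spanP=> [|y ys]; [exact: submodule_span | apply: mem_span; rewrite mem_cat ys].
- apply/spanP=> [|y ys]; first exact: submodule_span.
  by apply: mem_span; rewrite mem_cat ys orbT.
Qed.

Variable star : set K -> set K.
Hypothesis hstar : semistar star.

Lemma star_fS E F : E `<=` F -> star_f star E `<=` star_f star F.
Proof. by move=> EF x [G [fG GE] Gx]; exists G => //; split=> // y /GE /EF. Qed.

Lemma star_f_sub E : nonzero_submodule E -> star_f star E `<=` star E.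
Proof.
by move=> nE x [F [fF FE]]; apply: (semistar_mono hstar) => //; case: fF.
Qed.

Lemma star_f_fg F : nonzero_fg_submodule F -> star_f star F = star F.
Proof.
move=> fF; apply/seteqP; split; first by apply: star_f_sub; case: fF.
by move=> x Fx; exists F => //; split=> //; exact: subset_refl.
Qed.

Lemma star_f_finite_type : finite_type (star_f star).
Proof.
by move=> E x nE [F [fF FE] Fx]; exists F; split=> //; rewrite star_f_fg.
Qed.

Lemma star_f_ext E : nonzero_submodule E -> E `<=` star_f star E.
Proof.
move=> [sE [e Ee e0]] x Ex.
(* The second generator [e] keeps the span nonzero when [x = 0]. *)
have fF : nonzero_fg_submodule (span [:: x; e]).
  by apply: nonzero_fg_span e0; rewrite !inE eqxx orbT.
exists (span [:: x; e]); first split=> //.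
  by apply/spanP => // y; rewrite !inE => /orP[] /eqP ->.
by apply: (semistar_ext hstar); [case: fF | apply: mem_span; rewrite mem_head].
Qed.

Lemma star_f_submodule E :
  nonzero_submodule E -> nonzero_submodule (star_f star E).
Proof.
move=> nE; have [sE [e Ee e0]] := nE.
split; last by exists e => //; exact: star_f_ext.
have sstar F : nonzero_fg_submodule F -> submodule (star F).
  by case=> nF _; case: (semistar_submodule hstar nF).
split.
- have [F [fF FE] _] := star_f_ext nE Ee.
  by exists F => //; exact: submod0 (sstar _ fF).
- move=> x y [F [fF FE] Fx] [G [fG GE] Gy].
  have [H [fH HE FH GH]] := nonzero_fg_join sE fF fG FE GE.
  have [[nF _] [nG _] [nH _]] := And3 fF fG fH.
  exists H; first by split.
  apply: (submodD (sstar _ fH)).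
    exact: (semistar_mono hstar nF nH FH).
  exact: (semistar_mono hstar nG nH GH).
- by move=> a x [F [fF FE] Fx]; exists F => //; exact: submodZ (sstar _ fF) _ _ Fx.
Qed.

Lemma semistar_star_f : semistar (star_f star).
Proof.
(* Idempotence: the finitely many generators of [F] lie in $G^\star$ for a single finitely generated
   [G] inside [E], whence $F^\star \subseteq (G^\star)^\star = G^\star$. *)
have idem E x : nonzero_submodule E -> star_f star (star_f star E) x -> star_f star E x.
  move=> nE [F [fF FE] Fx]; have [nF [s Fs]] := fF.
  have [G [fG GE sG]] : exists G, [/\ nonzero_fg_submodule G, G `<=` E &
      forall y, y \in s -> star G y].
    have : forall y, y \in s -> star_f star E y.
      by apply/spanP; [case: (star_f_submodule nE) | rewrite -Fs].
    elim: s {F fF FE Fx nF Fs} => [_|y s IH sE].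
      have [_ [e Ee _]] := nE; have [F [fF FE] _] := star_f_ext nE Ee.
      by exists F; split.
    have [G [fG GE sG]] : exists G, [/\ nonzero_fg_submodule G, G `<=` E &
      forall y, y \in s -> star G y].
      by apply: IH => z zs; apply: sE; rewrite inE zs orbT.
    have [F [fF FE] Fy] := sE y (mem_head _ _).
    have [H [fH HE FH GH]] := nonzero_fg_join nE.1 fF fG FE GE.
    have [[nF _] [nG _] [nH _]] := And3 fF fG fH.
    exists H; split=> // z; rewrite inE => /orP[/eqP ->|/sG].
      exact: (semistar_mono hstar nF nH FH).
    exact: (semistar_mono hstar nG nH GH).
  exists G => //; have [nG _] := fG.
  have nG' := semistar_submodule hstar nG.
  rewrite -(semistar_idem hstar nG).
  apply: (semistar_mono hstar nF nG') Fx; rewrite Fs.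
  by apply/spanP; [case: nG' | ].
split.
- exact: star_f_submodule.
- move=> x E x0 nE; apply/seteqP; split=> [y [F [fF FE] Fy]|_ [y [F [fF FE] Fy] <-]].
    have xV0 : x^-1 != 0 by rewrite invr_eq0.
    apply/mem_scale_set => //; exists (scale_set x^-1 F).
      split; first exact: nonzero_fg_scale.
      by move=> _ [z /FE /mem_scale_set zE <-]; rewrite mulrC; exact: zE.
    rewrite (semistarZ hstar) //; last by case: fF.
    by exists y => //; rewrite mulrC.
  exists (scale_set x F).
    split; first exact: nonzero_fg_scale.
    by move=> _ [z /FE Ez <-]; exists z.
  by rewrite (semistarZ hstar) //; [exists y | case: fF].
- by move=> E F _ _; exact: star_fS.
- exact: star_f_ext.
- move=> E nE; apply/seteqP; split=> x; first exact: idem.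
  exact: star_f_ext (star_f_submodule nE) _.
Qed.

End FiniteType.

(** * Values of 1, of inverses and of powers *)

Section DiscreteValuation.
Variables (K : fieldType) (v : K -> int).
Hypothesis vP : discrete_valuation v.
Implicit Types x : K.

Lemma dval1 : v 1 = 0.
Proof.
have := dvalM vP (oner_neq0 _) (oner_neq0 _); rewrite mulr1 => /eqP.
by rewrite -subr_eq subrr eq_sym => /eqP.
Qed.

Lemma dvalV x : x != 0 -> v x^-1 = - v x.
Proof.
move=> x0; have := dvalM vP x0 (invr_neq0 x0).
by rewrite divff // dval1 => /esym/eqP; rewrite addr_eq0 => /eqP ->; rewrite opprK.
Qed.

Lemma dvalX x n : x != 0 -> v (x ^+ n) = v x *+ n.
Proof.
move=> x0; elim: n => [|n IH]; first by rewrite expr0 dval1.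
by rewrite exprS (dvalM vP) ?expf_neq0 // IH mulrS.
Qed.

End DiscreteValuation.

(** * A criterion for discrete valuation rings *)

Section ValuationRing.
Variables (K : fieldType) (V : set K).
Implicit Types x y : K.

(** Since [V (x / y)] says $xV \subseteq yV$, the last hypothesis is the maximum condition on
    principal ideals. It yields a uniformizer [p]; every nonzero [x] is a unit times a power of [p],
    and the exponent is the valuation. *)
Lemma is_DVR_valuation_ring :
    V 0 -> V 1 -> (forall x y, V x -> V y -> V (x + y)) ->
    (forall x y, V x -> V y -> V (x * y)) ->
    (forall x, x != 0 -> V x \/ V x^-1) ->
    (exists x, [/\ x != 0, V x & ~ V x^-1]) ->
    (forall P : set K, (exists x, [/\ x != 0, V x & P x]) ->
       exists x, [/\ x != 0, V x, P x &
         forall y, y != 0 -> V y -> P y -> V (x / y) -> V (y / x)]) ->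
  is_DVR V.
Proof.
move=> V0 V1 VD VM Vtotal Vnonfield Vmax.
have [p [p0 Vp pV pmax]] := Vmax (fun x => ~ V x^-1) Vnonfield.
have VX n : V (p ^+ n) by elim: n => [|n IH]; rewrite ?expr0 ?exprS //; exact: VM.
(* If [p] is a multiple of [x], maximality of $pV$ among the ideals of nonunits makes [x] a multiple
   of [p] as well. *)
have pdiv x : x != 0 -> V x -> ~ V x^-1 -> V (x / p).
  move=> x0 Vx xV; have [Vxp|] := Vtotal (p / x) (mulf_neq0 p0 (invr_neq0 x0)).
    exact: pmax.
  by rewrite invf_div.
have Vfact_nat x : x != 0 -> V x -> exists n, V (x / p ^+ n) /\ V (p ^+ n / x).
  move=> x0 Vx.
  (* Among the quotients of [x] by powers of [p], [y] generates a maximal ideal. A nonunit [y] could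
     be divided by [p] once more, and maximality would put $p^{-1} = (y/p)/y$ in [V]. *)
  have [|y [y0 Vy [n yn] ymax]] := Vmax (fun y => exists n, y = x / p ^+ n).
    by exists x; split=> //; exists 0%N; rewrite expr0 divr1.
  exists n; rewrite -[p ^+ n / x]invf_div -yn; split=> //.
  apply: contrapT => yV; apply: pV.
  have -> : p^-1 = y / p / y by rewrite mulrAC divff // mul1r.
  apply: ymax; first by rewrite mulf_neq0 ?invr_eq0.
  - exact: pdiv.
  - by exists n.+1; rewrite yn exprS invfM mulrAC mulrA.
  - by rewrite invf_div mulrCA divff // mulr1.
(* The exponent is also given, arbitrarily, at [x = 0], so that [choice] yields a function on the
   whole field. *)
have Vfact x : exists k : int, x != 0 -> V (x * p ^ (- k)) /\ V (p ^ k / x).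
  have [->|x0] := eqVneq x 0; first by exists 0.
  have [Vx|Vx] := Vtotal x x0.
    have [n [Vn Vn']] := Vfact_nat x x0 Vx; exists n%:Z => _.
    by rewrite -exprnN -exprnP.
  have [n [Vn Vn']] := Vfact_nat _ (invr_neq0 x0) Vx; exists (- n%:Z) => _.
  rewrite opprK -exprnN -exprnP; split; first by rewrite mulrC -[x]invrK.
  by rewrite mulrC.
have [v vE] := choice Vfact.
have Vpz k : V (p ^ k) -> 0 <= k.
  case: k => // n; rewrite NegzE -exprnN => Vn; exfalso; apply: pV.
  have -> : p^-1 = p ^+ n * p ^- n.+1.
    by rewrite exprSr invfM mulrA divff ?mul1r // expf_neq0.
  exact: VM.
have pz0 k : p ^ k != 0 by rewrite expfz_neq0.
(* Through [v_ge] and [v_eq] the axioms of a valuation become closure properties of [V]. *)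
have v_ge x k : x != 0 -> (k <= v x) <-> V (x * p ^ (- k)).
  move=> x0; have [Vx Vx'] := vE x x0; split=> [|Vk].
    rewrite -subr_ge0 => kv.
    have -> : x * p ^ (- k) = x * p ^ (- v x) * p ^ (v x - k).
      by rewrite -mulrA -expfzDr // addrA addNr add0r.
    apply: VM => //; move: kv; case: (v x - k) => // n _; exact: VX.
  rewrite -subr_ge0; apply: Vpz; rewrite expfzDr //.
  have -> : p ^ v x * p ^ (- k) = (p ^ v x / x) * (x * p ^ (- k)).
    by rewrite mulrA divfK.
  exact: VM.
have v_eq x k : x != 0 -> V (x * p ^ (- k)) -> V (p ^ k / x) -> v x = k.
  move=> x0 /(v_ge x k x0) kv Vk; apply/eqP; rewrite eq_le kv andbT -subr_ge0.
  have [Vx _] := vE x x0; apply: Vpz; rewrite expfzDr //.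
  have -> : p ^ k * p ^ (- v x) = (p ^ k / x) * (x * p ^ (- v x)).
    by rewrite mulrA divfK.
  exact: VM.
exists v; first split.
- move=> x y x0 y0; have [[Vx Vx'] [Vy Vy']] := (vE x x0, vE y y0).
  apply: v_eq; first by rewrite mulf_neq0.
    by rewrite opprD expfzDr // mulrACA; exact: VM.
  by rewrite expfzDr // invfM mulrACA; exact: VM.
- move=> x y x0 y0 xy0; apply/v_ge => //; rewrite mulrDl.
  by apply: VD; apply/v_ge; rewrite // ge_min lexx ?orbT.
- move=> k; exists (p ^ k) => //; apply: v_eq => //; rewrite -?expfzDr //.
    by rewrite subrr expr0z.
  by rewrite divff.
apply/seteqP; split=> x.
  move=> Vx; have [->|x0] := eqVneq x 0; [by left | right].
  by apply/v_ge => //; rewrite oppr0 expr0z mulr1.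
move=> [->//|]; have [->//|x0] := eqVneq x 0.
by move=> /(v_ge _ _ x0); rewrite oppr0 expr0z mulr1.
Qed.

End ValuationRing.

(** * Quasi-ideals of a semistar operation: closures, primality, existence of maximal ones *)

Section QuasiStarIdeals.
Variable D : idomainType.
Local Notation K := {fraction D}.
Local Notation domK := (@domK D).
Implicit Types (x y : K) (E F I J M : set K).

(** Without such an [I], each member of the family would have a strictly larger one, and iterating a
    choice [f] of these builds a chain that never stabilises. *)
Lemma noetherian_maximal (t : set K -> set K) (P : set (set K)) :
    star_Noetherian t -> (exists I, quasi_star_ideal t I /\ P I) ->
  exists I, [/\ quasi_star_ideal t I, P I &
    forall J, quasi_star_ideal t J -> P J -> I `<=` J -> J `<=` I].
Proof.
move=> noeth [I0 QI0]; apply: contrapT => nomax.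
pose T := {I | quasi_star_ideal t I /\ P I}.
have next (I : T) : exists J : T, sval I `<=` sval J /\ ~ (sval J `<=` sval I).
  case: I => I [qI PI] /=; apply: contrapT => noJ; apply: nomax.
  exists I; split=> // J qJ PJ IJ; apply: contrapT => JI; apply: noJ.
  by exists (exist _ J (conj qJ PJ)).
have [f fP] := choice next.
pose c n := iter n f (exist _ I0 QI0).
have [n|n|n cn] := noeth (fun n => sval (c n)).
- by case: (svalP (c n)).
- by case: (fP (c n)).
- by case: (fP (c n)) => _; apply; have := cn n.+1 (leqnSn n) => /= ->.
Qed.

Lemma ideal_eq_domK I : nonzero_ideal I -> I 1 -> I = domK.
Proof.
move=> [[sI _] ID] I1; apply/seteqP; split=> // x Dx.
by rewrite -[x]mulr1; exact: submodM.
Qed.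

Definition adjoin I (a : K) : set K :=
  [set x | exists m d, [/\ I m, domK d & x = m + d * a]].

Lemma adjoin_sub I a : I `<=` adjoin I a.
Proof. by move=> x Ix; exists x, 0; split; rewrite ?mul0r ?addr0 //; exact: domK0. Qed.

Lemma adjoin_mem I a : submodule I -> adjoin I a a.
Proof.
by move=> sI; exists 0, 1; split; rewrite ?mul1r ?add0r //; [exact: submod0 | exact: domK1].
Qed.

Lemma adjoin_subset I a E : submodule E -> I `<=` E -> E a -> adjoin I a `<=` E.
Proof.
move=> sE IE Ea _ [m [d [Im Dd ->]]].
by apply: (submodD sE); [exact: IE | exact: submodM].
Qed.

Lemma nonzero_ideal_adjoin I a :
  nonzero_ideal I -> domK a -> nonzero_ideal (adjoin I a).
Proof.
move=> [nI ID] Da; split; last first.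
  exact: adjoin_subset (submodule_domK D) ID Da.
have [sI _] := nI.
apply: (nonzero_submodule_sub nI); last exact: adjoin_sub.
split; first exact: adjoin_sub (submod0 sI).
- move=> _ _ [m [d [Im Dd ->]]] [n [e [In De ->]]]; exists (m + n), (d + e).
  by split; [exact: submodD | exact: domKD | rewrite mulrDl addrACA].
- move=> c _ [m [d [Im Dd ->]]].
  exists (FracField.tofrac c * m), (FracField.tofrac c * d).
  by split; [exact: submodZ | apply: domKM => //; exists c | rewrite mulrDr mulrA].
Qed.

Variable t : set K -> set K.
Hypothesis ht : semistar t.

Lemma quasi_starP I : nonzero_ideal I ->
  (forall x, domK x -> t I x -> I x) -> quasi_star_ideal t I.
Proof.
move=> nI tI; split=> //; have [nI' ID] := nI.
apply/seteqP; split=> x; last by move=> [tx Dx]; exact: tI.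
by move=> Ix; split; [exact: (semistar_ext ht) | exact: ID].
Qed.

Lemma quasi_star_mem I x : quasi_star_ideal t I -> domK x -> t I x -> I x.
Proof. by move=> [_ eqI] Dx tx; rewrite eqI. Qed.

(** Idempotence gives $(E^t \cap D)^t \subseteq E^t$. *)
Lemma quasi_star_closure E : nonzero_ideal E -> quasi_star_ideal t (t E `&` domK).
Proof.
move=> [nE ED]; have ntE := semistar_submodule ht nE.
have ntED : nonzero_submodule (t E `&` domK).
  apply: (nonzero_submodule_sub nE).
    by apply: submoduleI; [case: ntE | exact: submodule_domK].
  by move=> x Ex; split; [exact: (semistar_ext ht) | exact: ED].
apply: quasi_starP; first by split=> // x [].
move=> x Dx tx; split=> //; rewrite -(semistar_idem ht nE).
by apply: (semistar_mono ht ntED ntE) tx => y [].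
Qed.

(** If [a] is not in [M], maximality gives $1 \in (M, a)^t$. Then $b \in (b(M, a))^t \subseteq M^t$,
    because $bM$ and $ba$ lie in [M]. *)
Lemma quasi_star_maximal_prime M a b : quasi_star_maximal t M ->
  domK a -> domK b -> M (a * b) -> M a \/ M b.
Proof.
move=> [qM MD Mmax] Da Db Mab; apply: contrapT => /not_orP[Ma Mb]; apply: Ma.
have [[nM MsD] _] := qM; have [sM _] := nM.
have nMa := nonzero_ideal_adjoin (conj nM MsD) Da.
have sub := @semistar_ext _ _ ht _ nMa.1.
rewrite -(Mmax _ (quasi_star_closure nMa)); first by split=> //; apply/sub/adjoin_mem.
- move=> eqD.
  have b0 : b != 0 by apply/eqP => b0; apply: Mb; rewrite b0; exact: submod0.
  apply: Mb; apply: quasi_star_mem => //.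
  have : t (scale_set b (adjoin M a)) b.
    rewrite (semistarZ ht) //; last by case: nMa.
    exists 1; rewrite ?mulr1 //.
    by have : domK 1 by [exact: domK1]; rewrite -eqD => -[].
  apply: (semistar_mono ht) => //; first by apply: nonzero_submodule_scale; case: nMa.
  move=> _ [_ [m [d [Mm Dd ->]]] <-]; rewrite mulrDr.
  apply: (submodD sM); first exact: submodM.
  by rewrite mulrCA [b * a]mulrC; exact: submodM.
- by move=> x Mx; split; [apply/sub/adjoin_sub | exact: MsD].
Qed.

Hypothesis tfin : finite_type t.

(** Zorn's lemma applies because finite type makes the union of a chain of quasi-[t]-ideals a
    quasi-[t]-ideal. *)
Lemma quasi_star_maximal_exists I : quasi_star_ideal t I -> I <> domK ->
  exists2 M, quasi_star_maximal t M & I `<=` M.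
Proof.
move=> qI ID.
pose P X := X = set0 \/ [/\ quasi_star_ideal t X, X <> domK & I `<=` X].
have [|M [PM Mmax]] := @Zorn_bigcup _ P; last first.
  have IP : P I by right; split=> //; exact: subset_refl.
  have [[[_ [e Ie _]] _] _] := qI.
  case: PM => [M0|[qM MD IM]].
    by exfalso; apply: (Mmax I _ IP); rewrite M0; split=> [x //|/(_ e Ie)].
  exists M => //; split=> // J qJ JD MJ; apply/seteqP; split=> //.
  apply: contrapT => JM; apply: (Mmax J); first by split.
  by right; split=> // x /IM /MJ.
move=> F FP Ftot.
have [[X0 FX0 [x0 X0x0]]|Fempty] := pselect (exists2 X, F X & exists x, X x); last first.
  left; apply/seteqP; split=> // x [X FX Xx].
  by exfalso; apply: Fempty; exists X => //; exists x.
have FP' X x : F X -> X x -> [/\ quasi_star_ideal t X, X <> domK & I `<=` X].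
  by move=> /FP[->|].
have [qX0 _ IX0] := FP' _ _ FX0 X0x0.
right; set U := \bigcup_(X in F) X.
have sU : submodule U.
  split.
  - by exists X0 => //; apply: submod0; case: qX0 => -[[]].
  - move=> x y [X FX Xx] [Y FY Yy].
    have [[[[sX _] _] _] _ _] := FP' _ _ FX Xx.
    have [[[[sY _] _] _] _ _] := FP' _ _ FY Yy.
    by case: (Ftot X Y FX FY) => [XY|YX]; [exists Y | exists X] => //;
       apply: submodD => //; [exact: XY | exact: YX].
  - move=> a x [X FX Xx]; exists X => //.
    by have [[[[sX _] _] _] _ _] := FP' _ _ FX Xx; exact: submodZ.
have UD : U `<=` domK.
  by move=> x [X FX Xx]; have [[[_ XD] _] _ _] := FP' _ _ FX Xx; exact: XD.
have nU : nonzero_submodule U.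
  by apply: (nonzero_submodule_sub qX0.1.1) => // x X0x; exists X0.
split; last 2 first.
- move=> UeqD; have : U 1 by rewrite UeqD; exact: domK1.
  move=> [X FX X1]; have [[nX _] XD _] := FP' _ _ FX X1; apply: XD.
  exact: ideal_eq_domK.
- by move=> x Ix; exists X0 => //; exact: IX0.
apply: quasi_starP => // x Dx /(tfin nU)[G [fG GU Gx]].
have [nG [s Gs]] := fG.
(* As the chain is total, one member contains all the generators of [G]; its element [y] excludes
   [set0]. *)
have [X [FX [y Xy] sX]] : exists X, [/\ F X, exists y, X y & forall y, y \in s -> X y].
  have : forall y, y \in s -> U y by apply/spanP; rewrite -?Gs.
  elim: s {Gs} => [_|z s IH sU']; first by exists X0; split=> //; exists x0.
  have [|X [FX Xne sX]] := IH; first by move=> y ys; apply: sU'; rewrite inE ys orbT.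
  have [Y FY Yz] := sU' z (mem_head _ _).
  case: (Ftot X Y FX FY) => [XY|YX].
    by exists Y; split=> //; [exists z | move=> y; rewrite inE => /orP[/eqP->|/sX/XY]].
  by exists X; split=> // y; rewrite inE => /orP[/eqP->|/sX] //; exact: YX.
have [qX _ _] := FP' _ _ FX Xy; have [[nX _] _] := qX.
exists X => //; apply: quasi_star_mem => //; apply: (semistar_mono ht) Gx => //.
by rewrite Gs; apply/spanP => //; case: nX.
Qed.

End QuasiStarIdeals.

(** * Localization at a quasi-maximal ideal *)

Section Localization.
Variable D : idomainType.
Local Notation K := {fraction D}.
Local Notation domK := (@domK D).
Implicit Types (x y : K) (E F I J M : set K).

Definition valuation_at M := forall x, x != 0 -> localization M x \/ localization M x^-1.

Variable t : set K -> set K.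
Hypothesis ht : semistar t.
Variable M : set K.
Hypothesis maxM : quasi_star_maximal t M.
Local Notation DM := (localization M).

Let nM : nonzero_ideal M. Proof. by case: maxM => -[]. Qed.
Let sM : submodule M. Proof. by case: nM => -[]. Qed.

Lemma maximal_not1 : ~ M 1.
Proof. by case: maxM => _ MD _ M1; apply: MD; exact: ideal_eq_domK. Qed.

Lemma notin_maximal_neq0 s : ~ M s -> s != 0.
Proof. by move=> Ms; apply/eqP => s0; apply: Ms; rewrite s0; exact: submod0. Qed.

Lemma notin_maximalM s u : domK s -> domK u -> ~ M s -> ~ M u -> ~ M (s * u).
Proof. by move=> Ds Du Ms Mu /(quasi_star_maximal_prime ht maxM Ds Du)[]. Qed.

Lemma localization_dom x : domK x -> DM x.
Proof.
move=> Dx; exists x, 1.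
by split; rewrite ?divr1 //; [exact: domK1 | exact: maximal_not1].
Qed.

Lemma localization_inv s : domK s -> ~ M s -> DM s^-1.
Proof. by move=> Ds Ms; exists 1, s; split; rewrite ?mul1r //; exact: domK1. Qed.

Lemma localizationM x y : DM x -> DM y -> DM (x * y).
Proof.
move=> [a [s [Da Ds Ms ->]]] [b [u [Db Du Mu ->]]]; exists (a * b), (s * u).
by split; [exact: domKM | exact: domKM | exact: notin_maximalM | rewrite invfM mulrACA].
Qed.

Lemma localizationD x y : DM x -> DM y -> DM (x + y).
Proof.
move=> [a [s [Da Ds Ms ->]]] [b [u [Db Du Mu ->]]].
exists (a * u + b * s), (s * u); split; last first.
- by rewrite addf_div ?notin_maximal_neq0.
- exact: notin_maximalM.
- exact: domKM.
- by apply: domKD; exact: domKM.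
Qed.

Lemma localization_nonunit m : M m -> m != 0 -> ~ DM m^-1.
Proof.
move=> Mm m0 [a [s [Da Ds Ms eqm]]]; have s0 := notin_maximal_neq0 Ms; apply: Ms.
have -> : s = a * m.
  by apply: (mulIf (invr_neq0 m0)); rewrite mulfK // eqm mulrC divfK.
exact: submodM.
Qed.

(** The product of denominators of the generators serves for the whole span, and it stays outside
    the prime [M]. *)
Lemma clear_denominators E (u : seq K) : submodule E ->
    (forall x, x \in u -> exists s, [/\ domK s, ~ M s & E (s * x)]) ->
  exists s, [/\ domK s, ~ M s & forall x, span u x -> E (s * x)].
Proof.
move=> sE Eu.
suff [s [Ds Ms sEu]] : exists s, [/\ domK s, ~ M s & forall x, x \in u -> E (s * x)].
  exists s; split=> // x ux.
  have sE' : submodule [set x | E (s * x)].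
    split=> [|y z Ey Ez|a y Ey] /=; first by rewrite mulr0; exact: submod0.
      by rewrite mulrDr; exact: submodD.
    by rewrite mulrCA; exact: submodZ.
  exact: (spanP u sE').2 sEu x ux.
elim: u Eu => [_|y u IH Eu].
  by exists 1; split=> //; [exact: domK1 | exact: maximal_not1].
have [|s [Ds Ms sEu]] := IH; first by move=> x xu; apply: Eu; rewrite inE xu orbT.
have [v [Dv Mv Ev]] := Eu y (mem_head _ _).
exists (s * v); split; [exact: domKM | exact: notin_maximalM |].
move=> x; rewrite inE => /orP[/eqP->|/sEu Ex]; first by rewrite -mulrA; exact: submodM.
by rewrite [s * v]mulrC -mulrA; exact: submodM.
Qed.

Section ValuationAt.
Hypothesis valM : valuation_at M.

Lemma valuation_fraction x :
  exists a b, [/\ domK a, domK b, b != 0, x = a / b & ~ M a \/ ~ M b].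
Proof.
have [->|x0] := eqVneq x 0.
  exists 0, 1; split; rewrite ?mul0r ?oner_neq0 //; first exact: domK0.
    exact: domK1.
  by right; exact: maximal_not1.
have [[a [b [Da Db Mb ->]]]|[a [b [Da Db Mb xV]]]] := valM x0.
  by exists a, b; split=> //; [exact: notin_maximal_neq0 | right].
exists b, a; split=> //; last by left.
  by apply/eqP => a0; move: (invr_neq0 x0); rewrite xV a0 mul0r eqxx.
by rewrite -[x]invrK xV invf_div.
Qed.

(* Otherwise every [e] in [E] would lie in [y M D_M], so that [s y] lies in
   [(y M)^t = y M^t] for some [s] outside [M], whence [s] in [M^t]. *)
Lemma star_localization E y : finite_type t -> nonzero_submodule E -> t E y ->
  exists s, [/\ domK s, ~ M s & E (s * y)].
Proof.
move=> tfin nE /(tfin _ _ nE)[F [fF FE Fy]]; have [sE _] := nE.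
apply: contrapT => noE.
have y0 : y != 0.
  apply/eqP => y0; apply: noE; exists 1; rewrite y0 mulr0.
  by split; [exact: domK1 | exact: maximal_not1 | exact: submod0].
have [nF [u Fu]] := fF.
have syM := submodule_scale y sM.
have [|s [Ds Ms sF]] := clear_denominators (u := u) syM.
  move=> e eu; have Ee : E e by apply: FE; rewrite Fu; exact: mem_span.
  have [a [b [Da Db b0 eab Mab]]] := valuation_fraction (e / y).
  have be : b * e = a * y.
    by apply: (mulIf (invr_neq0 y0)); rewrite -mulrA eab mulfK // mulrC divfK.
  have Ma : M a.
    apply: contrapT => Ma; apply: noE; exists a; split=> //.
    by rewrite -be; exact: submodM.
  exists b; split=> //; first by case: Mab.
  by rewrite be; exists a => //; rewrite mulrC.
have s0 := notin_maximal_neq0 Ms.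
have qM : quasi_star_ideal t M by case: maxM.
apply: Ms; apply: (quasi_star_mem qM Ds).
have : t (scale_set y M) (s * y).
  have : scale_set s (t F) (s * y) by exists y.
  rewrite -(semistarZ ht) //.
  apply: (semistar_mono ht); first exact: nonzero_submodule_scale.
    by apply: nonzero_submodule_scale => //; case: nM.
  by move=> _ [x Fx <-]; apply: sF; rewrite -Fu.
rewrite (semistarZ ht) //; last by case: nM.
by move=> /(mem_scale_set _ _ y0); rewrite mulfK.
Qed.

(** An ideal of $D_M$ is determined by its contraction to [D], so the maximum condition on principal
    ideals of $D_M$ follows from the one on their contractions, which are quasi-[t]-ideals. *)
Lemma localization_DVR : finite_type t -> star_Noetherian t -> is_DVR DM.
Proof.
move=> tfin noeth.
(* The set is the contraction $xD_M \cap D$. *)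
have qI x : x != 0 -> DM x -> quasi_star_ideal t [set d | domK d /\ DM (d / x)].
  move=> x0 Dx.
  have nI : nonzero_ideal [set d | domK d /\ DM (d / x)].
    split; last by move=> d [].
    split.
      split=> [|a b [Da Dax] [Db Dbx]|c a [Da Dax]].
      - by split; [exact: domK0 | rewrite mul0r; exact/localization_dom/domK0].
      - by split; [exact: domKD | rewrite mulrDl; exact: localizationD].
      - have Dc : domK (FracField.tofrac c) by exists c.
        split; first exact: domKM.
        by rewrite -mulrA; apply: localizationM => //; exact: localization_dom.
    have [a [s [Da Ds Ms xas]]] := Dx; have s0 := notin_maximal_neq0 Ms.
    have a0 : a != 0 by apply/eqP => a0; move: x0; rewrite xas a0 mul0r eqxx.
    exists a => //; split=> //; rewrite xas invf_div mulrCA divff // mulr1.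
    exact: localization_dom.
  apply: quasi_starP => // y Dy /(star_localization tfin nI.1)[s [Ds Ms [_ sy]]].
  split=> //; have -> : y / x = s^-1 * (s * y / x).
    by rewrite !mulrA mulVf ?mul1r ?notin_maximal_neq0.
  by apply: localizationM => //; exact: localization_inv.
apply: is_DVR_valuation_ring.
- exact/localization_dom/domK0.
- exact/localization_dom/domK1.
- exact: localizationD.
- exact: localizationM.
- exact: valM.
- have [[_ [m Mm m0]] MD] := nM.
  by exists m; split; [|exact/localization_dom/MD | exact: localization_nonunit].
move=> P [x0 [x00 Dx0 Px0]].
have [|_ [_ [x [x_0 Dx Px ->]] Imax]] := @noetherian_maximal _ _
    (fun I => exists x, [/\ x != 0, DM x, P x & I = [set d | domK d /\ DM (d / x)]]) noeth.
  by exists [set d | domK d /\ DM (d / x0)]; split; [exact: qI | exists x0].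
exists x; split=> // y y0 Dy Py xy.
have [a [s [Da Ds Ms yas]]] := Dy; have s0 := notin_maximal_neq0 Ms.
(* As [a] and [y] differ by the unit [s] of $D_M$, it is enough to place [a] in $xD_M$. *)
have : domK a /\ DM (a / x).
  apply: (Imax _ (qI y y0 Dy)).
  - by exists y.
  - move=> d [Dd dx]; split=> //; have -> : d / y = d / x * (x / y) by rewrite mulrA divfK.
    exact: localizationM.
  - have a0 : a != 0 by apply/eqP => a0; move: y0; rewrite yas a0 mul0r eqxx.
    split=> //; rewrite yas invf_div mulrCA divff // mulr1.
    exact: localization_dom.
move=> [_ ax]; have -> : y / x = a / x * s^-1 by rewrite yas mulrAC.
by apply: localizationM => //; exact: localization_inv.
Qed.

End ValuationAt.

Lemma DVR_valuation_at : is_DVR DM -> valuation_at M.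
Proof.
rewrite /valuation_at => -[v vP ->] x x0 /=; rewrite (dvalV vP x0).
by have [vx|vx] := lerP 0 (v x); [left | right]; right; rewrite // oppr_ge0 ltW.
Qed.

(** This is rank one: for nonzero [x] in [M] and [y] in [I], a power of [x] is a multiple of [y] in
    $D_M$. So $s x^n \in I$ for some [s] outside [M], and primality puts [x] in [I]. *)
Lemma DVR_prime_eq I : is_DVR DM -> nonzero_ideal I -> I `<=` M ->
  (forall a b, domK a -> domK b -> I (a * b) -> I a \/ I b) -> I = M.
Proof.
move=> [v vP vDM] [[sI [y Iy y0]] ID] IM Iprime.
apply/seteqP; split=> // x Mx; have [_ MD] := nM.
have [->|x0] := eqVneq x 0; first exact: submod0.
have vx : 0 < v x.
  rewrite ltNge; apply/negP => vx; apply: (localization_nonunit Mx x0).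
  by rewrite vDM; right; rewrite (dvalV vP) // oppr_ge0.
have vy : 0 <= v y.
  have : DM y by apply: localization_dom; exact: ID.
  by rewrite vDM => -[y00|//]; move: y0; rewrite y00 eqxx.
(* The exponent $v(y)$ suffices because $v(x) \geq 1$. *)
have [a [s [Da Ds Ms xas]]] : DM (x ^+ `|v y|%N / y).
  rewrite vDM; right; rewrite (dvalM vP) ?invr_neq0 ?expf_neq0 //.
  rewrite (dvalV vP) // (dvalX vP) // subr_ge0.
  rewrite -[leLHS]gez0_abs // -mulr_natr natz.
  by rewrite ler_peMl //; move: vx; rewrite gtz0_ge1.
have DX n : domK (x ^+ n).
  elim: n => [|n IH]; first by rewrite expr0; exact: domK1.
  by rewrite exprS; apply: domKM => //; exact: MD.
have : I (s * x ^+ `|v y|%N).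
  have -> : s * x ^+ `|v y|%N = a * y.
    by apply: (mulIf (invr_neq0 y0)); rewrite -mulrA xas mulfK // mulrC divfK ?notin_maximal_neq0.
  exact: submodM.
move=> /(Iprime _ _ Ds (DX _))[/IM//|].
elim: `|v y|%N => [|n IH]; first by rewrite expr0 => /IM /maximal_not1.
by rewrite exprS => /(Iprime _ _ (MD _ Mx) (DX n))[//|/IH].
Qed.

(** A nonzero element [x] of least value in the union of the chain divides all the others in $D_M$;
    [N] is the index of a member containing it. *)
Lemma DVR_chain_stabilises (I : nat -> set K) : is_DVR DM ->
    (forall n, nonzero_ideal (I n)) ->
  exists N, forall n y, I n y -> exists s, [/\ domK s, ~ M s & I N (s * y)].
Proof.
move=> [v vP vDM] nI.
have vpos n x : I n x -> x != 0 -> 0 <= v x.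
  move=> Inx x0; have [_ ID] := nI n.
  have : DM x by apply: localization_dom; exact: ID.
  by rewrite vDM => -[x00|//]; move: x0; rewrite x00 eqxx.
pose P k := `[< exists n x, [/\ I n x, x != 0 & v x = k%:Z] >].
have [k /asboolP[N [x [INx x0 vx]]] kmin] : exists2 k, P k & forall j, P j -> (k <= j)%N.
  suff exP : exists k, P k by exists (ex_minn exP); case: ex_minnP.
  have [[_ [x Ix x0]] _] := nI 0%N.
  exists `|v x|%N; apply/asboolP; exists 0%N, x; split=> //.
  by rewrite gez0_abs //; exact: vpos Ix x0.
exists N => n y Iny; have [[sI _] _] := nI N.
have [->|y0] := eqVneq y 0.
  by exists 1; split; [exact: domK1 | exact: maximal_not1 | rewrite mulr0; exact: submod0].
have vy := vpos n y Iny y0.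
have [a [s [Da Ds Ms yas]]] : DM (y / x).
  rewrite vDM; right; rewrite (dvalM vP) ?invr_neq0 //.
  rewrite (dvalV vP) // subr_ge0 vx -[leRHS]gez0_abs //.
  by apply: kmin; apply/asboolP; exists n, y; rewrite gez0_abs.
exists s; split=> //.
have -> : s * y = a * x.
  by apply: (mulIf (invr_neq0 x0)); rewrite -mulrA yas mulfK // mulrC divfK ?notin_maximal_neq0.
exact: submodM.
Qed.

End Localization.

(** * Products of submodules and the ideal $I I^{-1}$ *)

Section Products.
Variable D : idomainType.
Local Notation K := {fraction D}.
Local Notation domK := (@domK D).
Implicit Types (x y : K) (E F I J M : set K).

Lemma submodule_mul_mem E F x y : E x -> F y -> submodule_mul E F (x * y).
Proof.
by move=> Ex Fy; exists 1%N, (fun=> x), (fun=> y); split=> //; rewrite big_ord1.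
Qed.

Lemma submodule_submodule_mul E F :
  submodule E -> submodule (submodule_mul E F).
Proof.
move=> sE; split.
- by exists 0%N, (fun=> 0), (fun=> 0); split; [case | case | rewrite big_ord0].
- move=> _ _ [n [e [f [Ee Ff ->]]]] [m [g [h [Eg Fh ->]]]].
  exists (n + m)%N, (fun i => match fintype.split i with inl j => e j | inr j => g j end),
    (fun i => match fintype.split i with inl j => f j | inr j => h j end).
  split=> [i|i|]; try by case: fintype.split.
  rewrite big_split_ord; congr (_ + _); apply: eq_bigr => i _.
    by rewrite -/(unsplit (inl i)) unsplitK.
  by rewrite -/(unsplit (inr i)) unsplitK.
- move=> a _ [n [e [f [Ee Ff ->]]]].
  exists n, (fun i => FracField.tofrac a * e i), f; split=> // [i|]; first exact: submodZ.
  by rewrite mulr_sumr; apply: eq_bigr => i _; rewrite mulrA.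
Qed.

Lemma mul_ideal_inv_mem I x f : ideal_inv I f -> I x -> domK (x * f).
Proof. by move=> If Ix; apply: If; exists x; rewrite // mulrC. Qed.

Lemma nonzero_ideal_mul_inv I :
  nonzero_ideal I -> nonzero_ideal (submodule_mul I (ideal_inv I)).
Proof.
move=> [[sI [x Ix x0]] ID]; split; last first.
  move=> _ [n [e [f [Ie If ->]]]]; apply: submodule_sum; first exact: submodule_domK.
  by move=> i; exact: mul_ideal_inv_mem.
split; first exact: submodule_submodule_mul.
exists (x * 1); last by rewrite mulr1.
apply: submodule_mul_mem => // _ [y Iy <-]; rewrite mul1r; exact: ID.
Qed.

End Products.

(** * Invertibility and the chain condition in terms of the localizations *)

Section Characterization.
Variable D : idomainType.
Local Notation K := {fraction D}.
Local Notation domK := (@domK D).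
Implicit Types (x y : K) (E F I J M : set K).
Variable t : set K -> set K.
Hypothesis ht : semistar t.
Hypothesis tfin : finite_type t.

Let star_invertible_fg :=
  forall I, nonzero_ideal I -> nonzero_fg_submodule I -> star_invertible t I.

(** Let $x = a/b$ and $I = (b, a)$. Some [f] in $I^{-1}$ has [b * f] or [a * f] outside [M]:
    otherwise $I I^{-1} \subseteq M$, and invertibility would put 1 in $M^t$. Now read $x$ as
    $(af)/(bf)$. *)
Lemma star_invertible_valuation_at M :
  star_invertible_fg -> quasi_star_maximal t M -> valuation_at M.
Proof.
move=> inv maxM x x0; have [qM MD _] := maxM; have [[nM MsD] _] := qM.
have [sM _] := nM.
have [a [b [Da Db b0 xab]]] := fraction_quotient x.
pose I := span [:: b; a].
have ID : I `<=` domK.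
  apply/spanP; first exact: submodule_domK.
  by move=> y; rewrite !inE => /orP[] /eqP ->.
have fI : nonzero_fg_submodule I by apply: nonzero_fg_span b0; rewrite mem_head.
have nI : nonzero_ideal I by split=> //; case: fI.
have [f If Mf] : exists2 f, ideal_inv I f & ~ M (b * f) \/ ~ M (a * f).
  apply: contrapT => noF; apply: (maximal_not1 maxM).
  have sub : submodule_mul I (ideal_inv I) `<=` M.
    move=> _ [n [e [f [Ie If ->]]]]; apply: submodule_sum => // i.
    have : ~ (~ M (b * f i) \/ ~ M (a * f i)) by move=> Mf; apply: noF; exists (f i).
    move=> /not_orP[/contrapT Mb /contrapT Ma].
    have s2 : submodule [set y | M (y * f i)].
      split=> [|y z My Mz|c y My] /=; first by rewrite mul0r; exact: submod0.
        by rewrite mulrDl; exact: submodD.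
      by rewrite -mulrA; exact: submodZ.
    apply: ((spanP [:: b; a] s2).2 _ _ (Ie i)) => y.
    by rewrite !inE => /orP[] /eqP ->.
  apply: (quasi_star_mem qM (domK1 D)).
  apply: (semistar_mono ht _ _ sub) => //; first by case: (nonzero_ideal_mul_inv nI).
  rewrite inv //; apply: (semistar_ext ht); last exact: domK1.
  exact: nonzero_submodule_domK.
have Dbf : domK (b * f) by apply: mul_ideal_inv_mem If _; apply: mem_span; rewrite mem_head.
have Daf : domK (a * f).
  by apply: mul_ideal_inv_mem If _; apply: mem_span; rewrite !inE eqxx orbT.
have f0 : f != 0.
  by apply/eqP => f0; case: Mf; rewrite f0 mulr0; apply; exact: submod0.
have xE : x = a * f / (b * f) by rewrite -mulf_div divff // mulr1.
case: Mf => [Mbf|Maf]; [left | right].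
  by exists (a * f), (b * f).
by exists (b * f), (a * f); rewrite xE invf_div.
Qed.

(** Divisibility in $D_M$ is total, so one of finitely many elements divides all of them. *)
Lemma valuation_at_principal M (u : seq K) : quasi_star_maximal t M ->
    valuation_at M -> (exists2 x, x \in u & x != 0) ->
  exists e, [/\ e \in u, e != 0 & forall x, x \in u -> localization M (x / e)].
Proof.
move=> maxM valM; have loc0 : localization M 0 by exact/(localization_dom maxM)/domK0.
have loc1 : localization M 1 by exact/(localization_dom maxM)/domK1.
elim: u => [[]//|a u IH].
have [u0|u0] := pselect (exists2 x, x \in u & x != 0).
  have [e [eu e0 ue]] := IH u0.
  have [->|a0] := eqVneq a 0.
    exists e; split=> // [|x]; rewrite inE ?eu ?orbT // => /orP[/eqP->|/ue//].
    by rewrite mul0r.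
  have [ae|] := valM (a / e) (mulf_neq0 a0 (invr_neq0 e0)).
    by exists e; split=> // [|x]; rewrite inE ?eu ?orbT // => /orP[/eqP->|/ue].
  rewrite invf_div => ea; exists a; split=> // [|x]; rewrite inE ?eqxx //.
  move=> /orP[/eqP->|/ue xe]; first by rewrite divff.
  have -> : x / a = x / e * (e / a) by rewrite mulrA divfK.
  exact: (localizationM ht maxM).
move=> [b bu b0]; have u00 x : x \in u -> x = 0.
  by move=> xu; apply: contrapT => /eqP x0; apply: u0; exists x.
have a0 : a != 0 by move: bu b0; rewrite inE => /orP[/eqP->//|/u00->]; rewrite eqxx.
exists a; split=> // [|x]; rewrite inE ?eqxx // => /orP[/eqP->|/u00->].
  by rewrite divff.
by rewrite mul0r.
Qed.

(** No quasi-maximal [M] contains $I I^{-1}$: if the generator [e] of [I] generates $I D_M$, a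
    common denominator [s] outside [M] gives $sI \subseteq eD$, so that $s = e (s/e)$ lies in $I
    I^{-1}$. *)
Lemma valuation_at_star_invertible :
  (forall M, quasi_star_maximal t M -> valuation_at M) -> star_invertible_fg.
Proof.
move=> val I nI fI; set J := submodule_mul I (ideal_inv I).
have nJ : nonzero_ideal J by exact: nonzero_ideal_mul_inv.
have [nJ' JD] := nJ; have nD := nonzero_submodule_domK D.
have [stJ _] := semistar_submodule ht nJ'.
apply/seteqP; split; first exact: (semistar_mono ht).
suff J1 : t J 1.
  rewrite -(semistar_idem ht nJ'); apply: (semistar_mono ht) => //.
    exact: (semistar_submodule ht).
  by move=> x Dx; rewrite -[x]mulr1; exact: submodM.
apply: contrapT => J1.
have [|M maxM JM] := quasi_star_maximal_exists ht tfin (quasi_star_closure ht nJ).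
  by move=> eqD; have := domK1 D; rewrite -eqD => -[].
have JM' : J `<=` M by move=> x Jx; apply: JM; split; [exact: (semistar_ext ht) | exact: JD].
have [u Iu u0] := nonzero_fgP fI.
have [e [eu e0 ue]] := valuation_at_principal maxM (val M maxM) u0.
have [|s [Ds Ms sI]] := clear_denominators ht maxM (u := u)
    (submodule_scale e (submodule_domK D)).
  move=> x xu; have [a [s [Da Ds Ms xe]]] := ue x xu; exists s; split=> //.
  apply/mem_scale_set => //; rewrite -mulrA xe mulrC divfK //.
  exact: (notin_maximal_neq0 maxM).
apply: Ms; have -> : s = e * (s / e) by rewrite mulrC divfK.
apply/JM'/submodule_mul_mem; first by rewrite Iu; exact: mem_span.
move=> _ [x Ix <-]; rewrite mulrAC; apply/mem_scale_set => //.
by apply: sI; rewrite -Iu.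
Qed.

Lemma noetherian_finite_maximal_over (d : K) : star_Noetherian t ->
    (forall M, quasi_star_maximal t M -> is_DVR (localization M)) ->
    domK d -> d != 0 ->
  finite_set [set M | quasi_star_maximal t M /\ M d].
Proof.
move=> noeth dvr Dd d0.
(* Noetherian induction runs over all quasi-[t]-ideals; the element [d] is treated through $(d)^t
   \cap D$, which is contained in every [M] containing [d]. *)
suff fin I : quasi_star_ideal t I ->
    finite_set [set M | quasi_star_maximal t M /\ I `<=` M].
  have [nE _] : nonzero_fg_submodule (span [:: d]).
    by apply: nonzero_fg_span d0; rewrite mem_head.
  have nEi : nonzero_ideal (span [:: d]).
    split=> //; apply/spanP; first exact: submodule_domK.
    by move=> y; rewrite inE => /eqP ->.
  apply: sub_finite_set (fin _ (quasi_star_closure ht nEi)).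
  move=> M [maxM Md]; split=> // x [tx Dx]; have [qM _ _] := maxM.
  have [[nM _] _] := qM; apply: (quasi_star_mem qM Dx).
  apply: (semistar_mono ht nE nM) tx; apply/spanP; first by case: nM.
  by move=> y; rewrite inE => /eqP ->.
move=> qI; apply: contrapT => infI.
(* From here on [I] is a maximal counterexample. *)
have [|{qI infI} {}I [qI infI Imax]] := noetherian_maximal
    (P := fun I => ~ finite_set [set M | quasi_star_maximal t M /\ I `<=` M]) noeth.
  by exists I.
have [nI _] := qI; have [nI' ID] := nI; have [sI _] := nI'.
apply: infI.
(* The closure of $(I, a)$ is strictly larger than [I], hence no counterexample, and the same [M]
   contain it as contain $(I, a)$. *)
have adj a : domK a -> ~ I a ->
    finite_set [set M | quasi_star_maximal t M /\ adjoin I a `<=` M].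
  move=> Da Ia; have nIa := nonzero_ideal_adjoin nI Da.
  have ext := @semistar_ext _ _ ht _ nIa.1.
  have qIa := quasi_star_closure ht nIa.
  have fin :
      finite_set [set M | quasi_star_maximal t M /\ t (adjoin I a) `&` domK `<=` M].
    apply: contrapT => inf; apply: Ia; apply: (Imax _ qIa inf).
      by move=> x Ix; split; [exact/ext/adjoin_sub | exact: ID].
    by split=> //; exact/ext/adjoin_mem.
  apply: sub_finite_set fin => M [maxM IaM]; split=> // x [tx Dx].
  have [qM _ _] := maxM; apply: (quasi_star_mem qM Dx).
  by apply: (semistar_mono ht _ _ IaM) tx; [case: nIa | case: qM => -[]].
have [Iprime|] := pselect (forall a b, domK a -> domK b -> I (a * b) -> I a \/ I b).
  apply: sub_finite_set (finite_set1 I) => M [maxM IM].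
  by rewrite /= (DVR_prime_eq maxM (dvr M maxM) nI IM Iprime).
move=> /existsNP[a /existsNP[b /not_implyP[Da /not_implyP[Db]]]].
move=> /not_implyP[Iab /not_orP[Ia Ib]].
have := conj (adj a Da Ia) (adj b Db Ib); rewrite -finite_setU.
apply: sub_finite_set => M [maxM IM]; have [[[nM _] _] _ _] := maxM; have [sM _] := nM.
by have [Ma|Mb] := quasi_star_maximal_prime ht maxM Da Db (IM _ Iab); [left | right];
  split=> //; apply: adjoin_subset.
Qed.

Lemma finite_maximal_noetherian :
    (forall M, quasi_star_maximal t M -> is_DVR (localization M)) ->
    (forall d : K, domK d -> d != 0 ->
       finite_set [set M | quasi_star_maximal t M /\ M d]) ->
  star_Noetherian t.
Proof.
move=> dvr fin I qI Iasc.
have nI n : nonzero_ideal (I n) by case: (qI n).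
have Imono n m : (n <= m)%N -> I n `<=` I m.
  move=> /subnKC <-; elim: (m - n)%N => [|k IH].
    by rewrite addn0; exact: subset_refl.
  by rewrite addnS => x /IH /Iasc.
(* The element [d] lies in every [I n], so only the finitely many [M] containing it have to be
   controlled. *)
have [[_ [d I0d d0]] ID0] := nI 0%N.
have Id n : I n d by apply: (Imono 0%N).
have Dd := ID0 _ I0d.
(* Sets that are not quasi-maximal get the index 0, which lets [choice] define [N] everywhere. *)
have stab M : exists N, quasi_star_maximal t M ->
    forall n y, I n y -> exists s, [/\ domK s, ~ M s & I N (s * y)].
  have [maxM|nmaxM] := pselect (quasi_star_maximal t M); last by exists 0%N.
  by have [N NP] := DVR_chain_stabilises maxM (dvr M maxM) nI; exists N.
have [N NP] := choice stab.
have /finite_seqP[u Nu] := finite_image N (fin d Dd d0).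
exists (\max_(n <- u) n) => m Nm; apply/seteqP; split; last exact: Imono.
set n := \max_(n <- u) n => x Ix.
have [[sn _] _] := nI n.
have [_ IDm] := nI m; have Dx := IDm _ Ix.
have [->|x0] := eqVneq x 0; first exact: submod0.
(* This is the colon ideal $(I_n :_D x)$, to be shown equal to [D]. It contains [d], so a
   quasi-maximal [M] above it is among the finitely many, and stabilisation at [M] produces an
   element of [J] outside [M]. *)
pose J := [set a | domK a /\ I n (a * x)].
have nJ : nonzero_ideal J.
  split; last by move=> a [].
  split; last by exists d => //; split=> //; rewrite mulrC; exact: submodM.
  split=> [|a b [Da Ia] [Db Ib]|c a [Da Ia]].
  - by split; [exact: domK0 | rewrite mul0r; exact: submod0].
  - by split; [exact: domKD | rewrite mulrDl; exact: submodD].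
  - by split; [apply: domKM => //; exists c | rewrite -mulrA; exact: submodZ].
have qJ : quasi_star_ideal t J.
  apply: quasi_starP => // y Dy tJy; split=> //.
  apply: (quasi_star_mem (qI n)); first exact: domKM.
  (* Since $xJ \subseteq I_n$, also $xJ^t = (xJ)^t \subseteq I_n^t$. *)
  have : scale_set x (t J) (y * x) by exists y; rewrite // mulrC.
  have [nJ' _] := nJ; rewrite -(semistarZ ht) //.
  apply: (semistar_mono ht); [exact: nonzero_submodule_scale | by case: (nI n) |].
  by move=> _ [z [_ Iz] <-]; rewrite mulrC.
have [JD|JD] := pselect (J = domK).
  have : J 1 by rewrite JD; exact: domK1.
  by case=> _; rewrite mul1r.
have [M maxM JM] := quasi_star_maximal_exists ht tfin qJ JD.
have Md : M d by apply: JM; split=> //; rewrite mulrC; exact: submodM.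
have [s [Ds Ms Is]] := NP M maxM m x Ix.
exfalso; apply: Ms; apply: JM; split=> //; apply: Imono Is.
have : [set` u] (N M) by rewrite -Nu; exists M.
by move=> Nin; exact: leq_bigmax_seq.
Qed.

End Characterization.

(** * The chain conditions for [star] and [star_f star] *)

Section NoetherianFiniteType.
Variable D : idomainType.
Local Notation K := {fraction D}.
Local Notation domK := (@domK D).
Implicit Types (x y : K) (E F I J M : set K).
Variable star : set K -> set K.
Hypothesis hstar : semistar star.

Lemma quasi_star_star_f I : quasi_star_ideal star I -> quasi_star_ideal (star_f star) I.
Proof.
move=> qI; have [nI _] := qI; apply: (quasi_starP (semistar_star_f hstar) nI) => x Dx.
by move=> /(star_f_sub hstar nI.1); exact: quasi_star_mem.
Qed.

(** Take [F] finitely generated in [I] with $F^\star \cap D$ maximal. Adjoining an element of [I] to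
    [F] does not enlarge it, so $I \subseteq F^\star$ and $I^\star \subseteq F^\star \subseteq
    I^{\star_f}$. *)
Lemma noetherian_quasi_star_f I : star_Noetherian star ->
  quasi_star_ideal (star_f star) I -> quasi_star_ideal star I.
Proof.
move=> noeth qI; have [nI _] := qI; have [nI' ID] := nI; have [sI [e Ie e0]] := nI'.
have span1 x : I x -> x != 0 -> nonzero_fg_submodule (span [:: x]) /\ span [:: x] `<=` I.
  move=> Ix x0; split; first by apply: nonzero_fg_span x0; rewrite mem_head.
  by apply/spanP => // y; rewrite inE => /eqP ->.
have qfg F : nonzero_fg_submodule F -> F `<=` I ->
    quasi_star_ideal star (star F `&` domK).
  by move=> [nF _] FI; apply: quasi_star_closure => //; split=> // x /FI /ID.
have [|_ [_ [F [fF FI ->]] Fmax]] := noetherian_maximal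
    (P := fun Q => exists F,
       [/\ nonzero_fg_submodule F, F `<=` I & Q = star F `&` domK]) noeth.
  have [fe eI] := span1 e Ie e0.
  by exists (star (span [:: e]) `&` domK); split; [exact: qfg | exists (span [:: e])].
have [nF _] := fF; have nF' := semistar_submodule hstar nF.
have IF : I `<=` star F.
  move=> x Ix; have [->|x0] := eqVneq x 0; first by case: nF' => -[].
  have [fx xI] := span1 x Ix x0.
  have [G [fG GI FG xG]] := nonzero_fg_join sI fF fx FI xI.
  have [nG _] := fG.
  have [] : (star F `&` domK) x => //.
  apply: (Fmax _ (qfg G fG GI)); first by exists G.
    by move=> y [Fy Dy]; split=> //; exact: (semistar_mono hstar nF nG FG).
  split; last exact: ID.
  by apply: (semistar_ext hstar nG); apply: xG; apply: mem_span; rewrite mem_head.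
apply: (quasi_starP hstar nI) => x Dx tx; apply: (quasi_star_mem qI Dx).
exists F => //; rewrite -(semistar_idem hstar nF).
exact: (semistar_mono hstar nI' nF' IF).
Qed.

Lemma star_f_noetherian : star_Noetherian (star_f star) <-> star_Noetherian star.
Proof.
split=> noeth I qI; apply: (noeth I) => n; first exact: quasi_star_star_f.
exact: noetherian_quasi_star_f (qI n).
Qed.

End NoetherianFiniteType.

(** * The cycle of implications between the three conditions *)

Theorem theorem4p11 (D : idomainType)
    (star : set {fraction D} -> set {fraction D}) (hstar : semistar star) :
  [<-> star_DD star;
       star_ADD star /\ finite_maximal_character star;
       star_Noetherian star /\ star_ADD star].
Proof.
have ht := semistar_star_f hstar; have tfin := star_f_finite_type hstar.
(* The other conditions are already expressed through [star_f star]; only the chain condition has to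
   be transported. *)
have noethE := star_f_noetherian hstar.
tfae.
- move=> [noeth inv].
  have dvr : star_ADD star.
    move=> M maxM; apply: (localization_DVR ht maxM) => //; last exact/noethE.
    exact: (star_invertible_valuation_at ht inv).
  split=> // d d0; apply: (noetherian_finite_maximal_over ht) => //; first exact/noethE.
    by exists d.
  by rewrite tofrac_eq0.
- move=> [dvr fin]; split=> //; apply/noethE.
  apply: (finite_maximal_noetherian ht tfin dvr) => _ [d _ <-].
  by rewrite tofrac_eq0; exact: fin.
- move=> [noeth dvr]; split=> //; apply: (valuation_at_star_invertible ht tfin) => M maxM.
  exact: (DVR_valuation_at (dvr M maxM)).
Qed.
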